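(* Let $(\mathcal{A}, G, \alpha)$ be a dynamical system with $\mathcal{A}$ unital, and suppose it is locally inner in some C*-cover $(\mathcal{C}, j)$ for $\mathcal{A}$. Then the following hold: (1) $(\mathcal{C}, j)$ is $\alpha$-admissible. (2) If $(\mathcal{D}, i)$ is any C*-cover for $\mathcal{A}$ such that $(\mathcal{D}, i)\preceq (\mathcal{C}, j)$, then $(\mathcal{D},i)$ is $\alpha$-admissible. In particular, $(\mathcal{A}, G, \alpha)$ is locally inner in $(\mathcal{D},i)$.
   Context: An (operator algebra) dynamical system $(\mathcal{A},G,\alpha)$ consists of an approximately unital (here: unital), possibly non-self-adjoint, operator algebra $\mathcal{A}$, a locally compact Hausdorff group $G$, and a strongly continuous group representation $\alpha:G\to\mathrm{Aut}(\mathcal{A})$ such that each $\alpha_s$ is a completely isometric automorphism. A C*-cover for $\mathcal{A}$ is a pair $(\mathcal{C},j)$ where $\mathcal{C}$ is a C*-algebra and $j:\mathcal{A}\to\mathcal{C}$ is a completely isometric homomorphism with $\mathcal{C}=C^*(j(\mathcal{A}))$. It is $\alpha$-admissible if there is a (necessarily unique) strongly continuous action $\tilde\alpha:G\to\mathrm{Aut}(\mathcal{C})$ by $*$-automorphisms with $\tilde\alpha_s\circ j=j\circ\alpha_s$ for all $s\in G$. Write $(\mathcal{D},i)\preceq(\mathcal{C},j)$ if there is a $*$-homomorphism $\pi:\mathcal{C}\to\mathcal{D}$ (necessarily surjective) with $\pi\circ j=i$. For a unitary $U$, $\mathrm{ad}(U)(x)=UxU^*$. The system $(\mathcal{A},G,\alpha)$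 is locally inner in $(\mathcal{C},j)$ if for each $s\in G$ there exists a unitary $U_s\in\mathcal{C}$ such that $\alpha_s=j^{-1}\circ\mathrm{ad}(U_s)\circ j$. No continuity or multiplicativity of $s\mapsto U_s$ is required. *)

(* Defs.v *)
From HB Require Import structures.
From mathcomp Require Import all_boot all_order all_algebra.
From mathcomp Require Import all_classical all_reals all_analysis.
From mathcomp.real_closed Require Import complex.

Set Implicit Arguments.
Unset Strict Implicit.
Unset Printing Implicit Defensive.

Import Order.TTheory GRing.Theory Num.Theory.
Import numFieldNormedType.Exports.

Local Open Scope classical_set_scope.
Local Open Scope complex_scope.
Local Open Scope ring_scope.

HB.mixin Record isTopologicalGroup G & Topological G & Group G := {
  mulg_continuous : continuous (fun p : G * G => (p.1 * p.2)%g) ;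
  invg_continuous : continuous (fun x : G => x^-1%g)
}.

#[short(type="topologicalGroupType")]
HB.structure Definition TopologicalGroup :=
  {G of Topological G & Group G & isTopologicalGroup G}.

(* Complex Banach algebras. MathComp rings have a unit, but C*-algebras and
   operator algebras need not: hence a separate, possibly non-unital, product. *)
HB.mixin Record isBanachAlgebra (R : realType) A
    & CompleteNormedModule R[i] A := {
  bmul : A -> A -> A ;
  bmulA : associative bmul ;
  bmulDl : left_distributive bmul +%R ;
  bmulDr : right_distributive bmul +%R ;
  bscaleAl : forall (k : R[i]) (x y : A), k *: bmul x y = bmul (k *: x) y ;
  bscaleAr : forall (k : R[i]) (x y : A), k *: bmul x y = bmul x (k *: y) ;
  normbM_le : forall x y : A, `|bmul x y| <= `|x| * `|y|
}.

#[short(type="banachAlgebraType")]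
HB.structure Definition BanachAlgebra (R : realType) :=
  {A of CompleteNormedModule R[i] A & isBanachAlgebra R A}.

Notation "x ** y" := (bmul x y) (at level 40, left associativity) : ring_scope.

HB.mixin Record isCStarAlgebra (R : realType) C & BanachAlgebra R C := {
  star : C -> C ;
  starK : involutive star ;
  starD : {morph star : x y / x + y} ;
  starZ : forall (k : R[i]) (x : C), star (k *: x) = Num.conj k *: star x ;
  starM : forall x y : C, star (x ** y) = star y ** star x ;
  cstar_identity : forall x : C, `|star x ** x| = `|x| ^+ 2
}.

#[short(type="cstarAlgebraType")]
HB.structure Definition CStarAlgebra (R : realType) :=
  {C of BanachAlgebra R C & isCStarAlgebra R C}.

Section Homomorphisms.
Variable R : realType.

Definition is_unit_of (A : banachAlgebraType R) (e : A) : Prop :=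
  forall x : A, e ** x = x /\ x ** e = x.

(* `|e| = 1 unless A is the zero algebra. *)
Definition unital (A : banachAlgebraType R) : Prop :=
  exists2 e : A, is_unit_of e & `|e| <= 1.

Definition algebra_hom (A B : banachAlgebraType R) (f : A -> B) : Prop :=
  linear f /\ {morph f : x y / x ** y}.

Definition star_hom (C D : cstarAlgebraType R) (f : C -> D) : Prop :=
  algebra_hom f /\ {morph f : x / star x}.

(* Such a u only exists if C has a unit, namely star u ** u. *)
Definition unitary (C : cstarAlgebraType R) (u : C) : Prop :=
  is_unit_of (star u ** u) /\ is_unit_of (u ** star u).

Definition ad (C : cstarAlgebraType R) (u x : C) : C := u ** x ** star u.

End Homomorphisms.

Section MatrixNorms.
Variables (R : realType) (C : cstarAlgebraType R).

(* mulmx is not available for entries in a non-unital algebra. *)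
Definition bmulmx n (X Y : 'M[C]_n) : 'M[C]_n :=
  \matrix_(i, j) \sum_k X i k ** Y k j.

Definition starmx n (X : 'M[C]_n) : 'M[C]_n := \matrix_(i, j) star (X j i).

Record cstar_norm n (N : 'M[C]_n -> R[i]) : Prop := CStarNorm {
  cstar_normD : forall X Y, N (X + Y) <= N X + N Y ;
  cstar_normZ : forall k X, N (map_mx ( *:%R k) X) = `|k| * N X ;
  cstar_norm0_eq0 : forall X, N X = 0 -> X = 0 ;
  cstar_normM : forall X Y, N (bmulmx X Y) <= N X * N Y ;
  cstar_norm_starM : forall X, N (bmulmx (starmx X) X) = N X ^+ 2
}.

(* The canonical matrix norms of C: M_n(C) carries exactly one C*-norm (for
   which it is then automatically complete), so at most one family N satisfies
   this. *)
Definition cstar_mxnorms (N : forall n, 'M[C]_n -> R[i]) : Prop :=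
  (forall n, cstar_norm (N n)) /\ (forall c : C, N 1 (const_mx c) = `|c|).

Definition mx_isometric (A : banachAlgebraType R)
    (NA : forall n, 'M[A]_n -> R[i]) (f : A -> C) : Prop :=
  exists2 N : forall n, 'M[C]_n -> R[i], cstar_mxnorms N
    & forall n (X : 'M[A]_n), N n (map_mx f X) = NA n X.

End MatrixNorms.

(* An operator algebra is a Banach algebra with matrix norms which is, up to a
   completely isometric isomorphism, a (necessarily closed) subalgebra of a
   C*-algebra with the inherited matrix norms. *)
HB.mixin Record isOperatorAlgebra (R : realType) A & BanachAlgebra R A := {
  mxnorm : forall n, 'M[A]_n -> R[i] ;
  mxnorm1 : forall a : A, mxnorm 1 (const_mx a) = `|a| ;
  operator_algebra_rep : exists (B : cstarAlgebraType R) (f : A -> B),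
    algebra_hom f /\ mx_isometric mxnorm f
}.

#[short(type="operatorAlgebraType")]
HB.structure Definition OperatorAlgebra (R : realType) :=
  {A of BanachAlgebra R A & isOperatorAlgebra R A}.

Section CStarCovers.
Variables (R : realType) (A : operatorAlgebraType R).

Definition completely_isometric (C : cstarAlgebraType R) (f : A -> C) : Prop :=
  mx_isometric (@mxnorm R A) f.

Definition closed_star_subalgebra (C : cstarAlgebraType R) (S : set C) : Prop :=
  [/\ closed S,
      S 0 /\ (forall (k : R[i]) x y, S x -> S y -> S (k *: x + y)),
      (forall x y, S x -> S y -> S (x ** y))
    & (forall x, S x -> S (star x))].

Definition generated_cstar (C : cstarAlgebraType R) (X : set C) : set C :=
  smallest (@closed_star_subalgebra C) X.

Definition cstar_cover (C : cstarAlgebraType R) (j : A -> C) : Prop :=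
  [/\ algebra_hom j, completely_isometric j
    & generated_cstar (range j) = [set: C]].

Definition cover_le (D : cstarAlgebraType R) (i : A -> D)
    (C : cstarAlgebraType R) (j : A -> C) : Prop :=
  exists2 pi : C -> D, star_hom pi & pi \o j = i.

End CStarCovers.

Section DynamicalSystems.
Variables (R : realType) (A : operatorAlgebraType R) (G : topologicalGroupType).

Definition is_action (T : Type) (a : G -> T -> T) : Prop :=
  a 1%g = id /\ (forall s t, a (s * t)%g = a s \o a t).

Definition strongly_continuous (T : topologicalType) (a : G -> T -> T) : Prop :=
  forall x, continuous (fun s => a s x).

Definition completely_isometric_aut (f : A -> A) : Prop :=
  [/\ bijective f, algebra_hom f
    & forall n (X : 'M[A]_n), mxnorm n (map_mx f X) = mxnorm n X].

Definition star_aut (C : cstarAlgebraType R) (f : C -> C) : Prop :=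
  bijective f /\ star_hom f.

Definition dynamical_system (alpha : G -> A -> A) : Prop :=
  [/\ locally_compact [set: G], hausdorff_space G,
      is_action alpha, strongly_continuous alpha
    & forall s, completely_isometric_aut (alpha s)].

Definition admissible (alpha : G -> A -> A) (C : cstarAlgebraType R)
    (j : A -> C) : Prop :=
  exists talpha : G -> C -> C,
    [/\ is_action talpha, strongly_continuous talpha,
        forall s, star_aut (talpha s)
      & forall s, talpha s \o j = j \o alpha s].

(* j is injective, so the displayed equation says both that ad u maps the range
   of j into itself and that alpha s = j^-1 \o ad u \o j. *)
Definition locally_inner (alpha : G -> A -> A) (C : cstarAlgebraType R)
    (j : A -> C) : Prop :=
  forall s, exists2 u : C, unitary u & j \o alpha s = ad u \o j.

End DynamicalSystems.

(* Main.v *)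
Require Import Defs.
From mathcomp Require Import all_boot all_order all_algebra.
From mathcomp Require Import all_classical all_reals all_analysis.
From mathcomp.real_closed Require Import complex.

Import Order.TTheory GRing.Theory Num.Theory.
Import numFieldNormedType.Exports.
Local Open Scope classical_set_scope.
Local Open Scope ring_scope.

(** Conjugation by a unitary of [C] is an automorphism of all of [C], so the
    only candidate for the action on [C] is [s |-> ad (U s)], where [U s] is
    any choice of unitaries implementing [alpha s].  Nothing is known about how
    [U s] depends on [s], and [s |-> U s] need not be multiplicative or
    continuous; but both the group law and the continuity of [s |-> ad (U s) x]
    only involve the automorphisms [ad (U s)], which on [range j] are dictated
    by [alpha].  Both properties spread from [range j] to [C] because the set
    of [x] where they hold is a closed star-subalgebra ([cover_ind]).  Both
    cases rest on [closed_star_subalgebra_cvg]: the points where a family of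
    contractive star-homomorphisms converges to a given one form a closed
    star-subalgebra.  Equality of two homomorphisms is the case of a constant
    family.

    For a smaller cover [(D, i)], with [pi : C -> D] satisfying [pi \o j = i],
    the elements [pi (U s)] implement [alpha] in [D], so [alpha] is locally
    inner in [D], hence [D] is admissible by the first part.  The point is that
    [pi (U s)] is unitary.  Usually one invokes the surjectivity of [pi], that
    is, the closedness of the range of a star-homomorphism.  Here it is enough
    that [pi] maps the unit of [C] to a unit of [D]: its image acts as a unit
    on [range i], and the elements on which a given self-adjoint element acts
    as a unit form a closed star-subalgebra
    ([closed_star_subalgebra_unit]). *)

(** * Continuity of the product *)

Section BanachAlgebras.
Context {R : realType} {A : banachAlgebraType R}.
Implicit Types x y z : A.

Lemma bmulNl x y : (- x) ** y = - (x ** y).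
Proof. by rewrite -scaleN1r -bscaleAl scaleN1r. Qed.

Lemma bmulNr x y : x ** (- y) = - (x ** y).
Proof. by rewrite -scaleN1r -bscaleAr scaleN1r. Qed.

Lemma bmulBl x y z : (x - y) ** z = x ** z - y ** z.
Proof. by rewrite bmulDl bmulNl. Qed.

Lemma bmulBr x y z : x ** (y - z) = x ** y - x ** z.
Proof. by rewrite bmulDr bmulNr. Qed.

Lemma cvg_bmul T (F : set_system T) {FF : Filter F} (f g : T -> A) (a b : A) :
  f t @[t --> F] --> a -> g t @[t --> F] --> b ->
  f t ** g t @[t --> F] --> a ** b.
Proof.
(* The error is at most d * (|b| + |a| + 1) when [f t] and [g t] are d-close to
   their limits and [g t] is moreover 1-close: the latter bounds the product of
   the two differences by d. *)
move=> /cvgrPdist_le fa /cvgrPdist_le gb; apply/cvgrPdist_le => e e0.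
have n0 : 0 < 1 + `|a| + `|b| by rewrite -addrA ltr_pwDl// addr_ge0.
have d0 : 0 < e / (1 + `|a| + `|b|) by rewrite divr_gt0.
near=> t.
have ht : `|a - f t| <= e / (1 + `|a| + `|b|).
  by near: t; exact: fa.
have kt : `|b - g t| <= e / (1 + `|a| + `|b|).
  by near: t; exact: gb.
have k1 : `|b - g t| <= 1 by near: t; exact: gb.
have -> : a ** b - f t ** g t =
    (a - f t) ** b + a ** (b - g t) - (a - f t) ** (b - g t).
  have -> : f t ** g t = (a - (a - f t)) ** (b - (b - g t)) by rewrite !subKr.
  move: (a - f t) (b - g t) => x y.
  by rewrite bmulBl !bmulBr opprB addrCA subKr addrAC.
apply: le_trans (ler_normB _ _) _.
apply: (@le_trans _ _ (e / (1 + `|a| + `|b|) * (`|b| + `|a| + 1))).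
  rewrite 2!mulrDr; apply: lerD; first apply: (le_trans (ler_normD _ _)).
    apply: lerD; apply: le_trans (normbM_le _ _) _; first exact: ler_wpM2r.
    by rewrite mulrC ler_wpM2r.
  by apply: le_trans (normbM_le _ _) _; rewrite ler_pM.
have -> : `|b| + `|a| + 1 = 1 + `|a| + `|b|
  by rewrite addrC [_ + `|a|]addrC addrA.
by rewrite divfK// gt_eqF.
Unshelve. all: by end_near. Qed.

End BanachAlgebras.

(** * Unitaries and inner automorphisms *)

Section CStarAlgebras.
Context {R : realType} {C : cstarAlgebraType R}.
Implicit Types (x y e u : C).

Lemma starB x y : star (x - y) = star x - star y.
Proof. by rewrite starD -scaleN1r starZ rmorphN1 scaleN1r. Qed.

Lemma norm_star x : `|star x| = `|x|.
Proof.
have le_star y : `|y| <= `|star y|.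
  have [->|y0] := eqVneq y 0; first by rewrite normr0.
  have n0 : 0 < `|y| by rewrite normr_gt0.
  by rewrite -(ler_pM2r n0) -expr2 -cstar_identity normbM_le.
by apply/eqP; rewrite eq_le le_star -{2}(starK x) le_star.
Qed.

Lemma cvg_star T (F : set_system T) {FF : Filter F} (f : T -> C) (a : C) :
  f t @[t --> F] --> a -> star (f t) @[t --> F] --> star a.
Proof.
move=> /cvgrPdist_le fa; apply/cvgrPdist_le => e e0.
near=> t; rewrite -starB norm_star; near: t; exact: fa.
Unshelve. all: by end_near. Qed.

(** A unit is self-adjoint, so the C*-identity gives |e| = |e|^2. *)
Lemma norm_unit_le1 e : is_unit_of e -> `|e| <= 1.
Proof.
move=> e1; have ee : star e ** e = e.
  by apply: (can_inj starK); rewrite starM starK (e1 (star e)).2.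
have [->|e0] := eqVneq e 0; first by rewrite normr0 ler01.
have n0 : 0 < `|e| by rewrite normr_gt0.
by rewrite -(ler_pM2r n0) mul1r -expr2 -cstar_identity ee.
Qed.

Lemma norm_unitary_le1 u : unitary u -> `|u| <= 1.
Proof.
move=> [/norm_unit_le1]; rewrite cstar_identity => + _.
by rewrite expr_le1.
Qed.

Lemma unitary_star u : unitary u -> unitary (star u).
Proof. by rewrite /unitary starK => -[]. Qed.

Lemma adK u : unitary u -> cancel (ad u) (ad (star u)).
Proof.
move=> [uu _] x; rewrite /ad starK !bmulA (uu x).1.
by rewrite -bmulA (uu x).2.
Qed.

Lemma ad_star_hom u : unitary u -> star_hom (ad u).
Proof.
move=> [uu _]; rewrite /ad; split; first split.
- by move=> k x y; rewrite bmulDr bmulDl bscaleAl bscaleAr.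
- move=> x y; have e : x ** y = x ** (star u ** u) ** y by rewrite (uu x).2.
  by rewrite e !bmulA.
- by move=> x; rewrite !starM starK bmulA.
Qed.

Lemma ad_star_aut u : unitary u -> star_aut (ad u).
Proof.
move=> uu; split; last exact: ad_star_hom.
exists (ad (star u)); first exact: adK.
by have := adK _ (unitary_star _ uu); rewrite starK.
Qed.

Lemma norm_ad_le u x : unitary u -> `|ad u x| <= `|x|.
Proof.
move=> /norm_unitary_le1 u1; rewrite /ad.
apply: le_trans (normbM_le _ _) _; rewrite norm_star.
apply: le_trans (ler_wpM2l _ u1) _ => //; rewrite mulr1.
by apply: le_trans (normbM_le _ _) _; rewrite ler_piMl.
Qed.

End CStarAlgebras.

(** * Closed star-subalgebras *)

Section StarHoms.
Context {R : realType} {C D : cstarAlgebraType R}.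

Lemma star_homB (f : C -> D) x y : star_hom f -> f (x - y) = f x - f y.
Proof.
by move=> [[lf _] _]; rewrite addrC -scaleN1r lf scaleN1r addrC.
Qed.

(** The algebraic closure properties are the continuity of the operations.
    Topological closedness uses that the maps are uniformly contractive: at
    [x], the error exceeds the error at a nearby [y] by at most 2 |x - y|. *)
Lemma closed_star_subalgebra_cvg T (F : set_system T) {FF : Filter F}
    (f : T -> C -> D) (g : C -> D) :
  (forall t, star_hom (f t)) -> star_hom g ->
  (forall t x, `|f t x| <= `|x|) -> (forall x, `|g x| <= `|x|) ->
  closed_star_subalgebra [set x | f t x @[t --> F] --> g x].
Proof.
move=> fhom ghom fle gle; split.
- move=> x clx; apply/cvgrPdist_le => e e0.
  have e3 : 0 < e / 3%:R by rewrite divr_gt0.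
  have [y [/= /cvgrPdist_le fy xy]] := clx _ (nbhsx_ballx x _ e3).
  have {}xy : `|x - y| <= e / 3%:R by move: xy; rewrite -ball_normE => /ltW.
  near=> t.
  have yt : `|g y - f t y| <= e / 3%:R by near: t; exact: fy.
  have -> : g x - f t x = g (x - y) + (g y - f t y) - f t (x - y).
    rewrite (star_homB _ _ _ ghom) (star_homB _ _ _ (fhom t)).
    by rewrite addrA subrK opprB addrA subrK.
  rewrite (_ : e = e / 3%:R + e / 3%:R + e / 3%:R); last first.
    by rewrite -!mulrDl -mulr2n -mulrSr -[e *+ 3]mulr_natr mulfK// pnatr_eq0.
  apply: le_trans (ler_normB _ _) _; apply: lerD.
    apply: le_trans (ler_normD _ _) _; apply: lerD => //.
    exact: le_trans (gle _) xy.
  exact: le_trans (fle _ _) xy.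
- split=> [|k x y /= fx fy].
    have hom0 (h : C -> D) : star_hom h -> h 0 = 0.
      by move=> hh; rewrite -(subrr 0) star_homB// subrr.
    rewrite /= hom0//; under eq_fun do rewrite hom0//.
    exact: cvg_cst.
  rewrite ghom.1.1; under eq_fun do rewrite (fhom _).1.1.
  by apply: cvgD => //; apply: cvgZl_tmp.
- move=> x y /= fx fy; rewrite ghom.1.2.
  under eq_fun do rewrite (fhom _).1.2.
  exact: cvg_bmul.
- move=> x /= fx; rewrite ghom.2; under eq_fun do rewrite (fhom _).2.
  exact: cvg_star.
Unshelve. all: by end_near. Qed.

(** A constant family converges to its own value only, so this is convergence
    along a trivial filter. *)
Lemma closed_star_subalgebra_eq (f g : C -> D) : star_hom f -> star_hom g ->
  (forall x, `|f x| <= `|x|) -> (forall x, `|g x| <= `|x|) ->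
  closed_star_subalgebra [set x | f x = g x].
Proof.
move=> fh gh fle gle.
have -> : [set x | f x = g x] =
    [set x | f x @[_ --> globally [set: unit]] --> g x].
  apply/seteqP; split=> x /= => [->|fg]; first exact: cvg_cst.
  have P : ProperFilter (globally [set: unit]).
    exact: (@globally_properfilter _ _ tt).
  by apply: (@cvg_unique _ (@norm_hausdorff _ D) _ _ _ _ _ fg); exact: cvg_cst.
exact: closed_star_subalgebra_cvg.
Qed.

End StarHoms.

Section UnitSubalgebra.
Context {R : realType} {D : cstarAlgebraType R}.

(** Both identities are needed for stability under [star], which exchanges
    them when [p] is self-adjoint. *)
Lemma closed_star_subalgebra_unit (p : D) : star p = p ->
  closed_star_subalgebra [set y | p ** y = y /\ y ** p = y].
Proof.
move=> sp; split.
- have fix_closed (f : D -> D) : continuous f -> closed [set y | f y = y].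
    move=> fc.
    have -> : [set y | f y = y] = (fun y => f y - y) @^-1` [set 0].
      apply/seteqP; split=> z /=; first by move=> ->; rewrite subrr.
      by move/eqP; rewrite subr_eq0 => /eqP.
    apply: preimage_closed => [z _|].
      by apply: cvgB; [exact: fc|exact: cvg_id].
    apply: accessible_closed_set1; apply: hausdorff_accessible.
    exact: norm_hausdorff.
  apply: closedI; apply: fix_closed => z.
    by apply: cvg_bmul; [exact: cvg_cst|exact: cvg_id].
  by apply: cvg_bmul; [exact: cvg_id|exact: cvg_cst].
- split=> [|k x y [px xp] [py yp]].
    by rewrite /= -(scale0r p) -bscaleAr -bscaleAl !scale0r.
  by rewrite /= bmulDr bmulDl -bscaleAr -bscaleAl px xp py yp.
- by move=> x y [px xp] [py yp]; rewrite /= bmulA px -bmulA yp.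
- by move=> x [px xp]; split; rewrite -[in LHS]sp -starM ?px ?xp.
Qed.

End UnitSubalgebra.

(** * C*-covers *)

Section Covers.
Context {R : realType} {A : operatorAlgebraType R} {C : cstarAlgebraType R}.
Context (j : A -> C) (coverj : cstar_cover j).

Lemma cover_ind (S : set C) : closed_star_subalgebra S ->
  (forall a, S (j a)) -> forall x, S x.
Proof.
case: coverj => _ _ gen cS Sj x.
have : generated_cstar (range j) x by rewrite gen.
by apply: smallest_sub => // _ [a _ <-].
Qed.

(** The norms of [A] and [C] are their matrix norms in size 1. *)
Lemma cover_isometry a : `|j a| = `|a|.
Proof.
case: coverj => _ [N [_ N1] Nj] _.
rewrite -N1 -(mxnorm1 a) -Nj; congr (N 1%N _).
by apply/matrixP => i k; rewrite !mxE.
Qed.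

Lemma cover_continuous : continuous j.
Proof.
have jB x y : j (x - y) = j x - j y.
  case: coverj => -[lj _] _ _.
  by rewrite addrC -scaleN1r lj scaleN1r addrC.
move=> a; apply/cvgrPdist_le => e e0.
near=> x; rewrite -jB cover_isometry; near: x.
by have /cvgrPdist_le := @cvg_id _ (nbhs a); exact.
Unshelve. all: by end_near. Qed.

End Covers.

(** * Locally inner actions *)

(** Replacing [U s] by another unitary implementing [alpha s] on [range j] does
    not change [ad (U s)], since two such automorphisms agree on a generating
    set; this is why an arbitrary choice yields a continuous action. *)
Lemma locally_inner_admissible {R : realType} {A : operatorAlgebraType R}
    {G : topologicalGroupType} {alpha : G -> A -> A}
    {C : cstarAlgebraType R} {j : A -> C} :
  is_action alpha -> strongly_continuous alpha ->
  cstar_cover j -> locally_inner alpha j -> admissible alpha j.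
Proof.
move=> [alpha1 alphaM] alphac cj inner.
have /choice[U UP] : forall s, exists u : C,
    unitary u /\ j \o alpha s = ad u \o j.
  by move=> s; have [u ? ?] := inner s; exists u.
have Uu s := (UP s).1.
have jU s a : j (alpha s a) = ad (U s) (j a) := congr1 (@^~ a) (UP s).2.
have idhom : star_hom (@id C) by split.
exists (fun s => ad (U s)); split.
- split=> [|s t]; apply/funext => x.
    apply: (cover_ind _ cj [set x | ad (U 1%g) x = id x]).
      apply: closed_star_subalgebra_eq => // [|y]; first exact: ad_star_hom.
      exact: norm_ad_le.
    by move=> a /=; rewrite -jU alpha1.
  apply: (cover_ind _ cj
    [set x | ad (U (s * t)%g) x = (ad (U s) \o ad (U t)) x]).
    apply: closed_star_subalgebra_eq => [|||y].
    + exact: ad_star_hom.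
    + have [[ls ms] ss] := ad_star_hom _ (Uu s).
      have [[lt mt] st] := ad_star_hom _ (Uu t).
      split; first split.
      * by move=> k y z /=; rewrite lt ls.
      * by move=> y z /=; rewrite mt ms.
      * by move=> y /=; rewrite st ss.
    + by move=> y; exact: norm_ad_le.
    + exact: le_trans (norm_ad_le _ _ (Uu s)) (norm_ad_le _ _ (Uu t)).
  by move=> a /=; rewrite -!jU alphaM.
- move=> x s.
  apply: (cover_ind _ cj [set x | ad (U t) x @[t --> s] --> ad (U s) x]).
    apply: closed_star_subalgebra_cvg.
    + by move=> t; exact: ad_star_hom.
    + exact: ad_star_hom.
    + by move=> t y; exact: norm_ad_le.
    + by move=> y; exact: norm_ad_le.
  move=> a /=; rewrite -jU; under eq_fun do rewrite -jU.
  by apply: continuous_comp; [exact: alphac|exact: cover_continuous].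
- by move=> s; exact: ad_star_aut.
- by move=> s; rewrite (UP s).2.
Qed.

(** A star-homomorphism between unital C*-algebras need not preserve the unit;
    this one does because [pi (star u ** u)] acts as a unit on the generating
    set [range i]. *)
Lemma cover_le_unitary {R : realType} {A : operatorAlgebraType R}
    {C D : cstarAlgebraType R} {i : A -> D} {j : A -> C} (pi : C -> D) :
  cstar_cover i -> star_hom pi -> pi \o j = i ->
  forall u, unitary u -> unitary (pi u).
Proof.
move=> ci [[_ piM] pis] pij u [uu1 uu2].
have unit_pi e : star e = e -> is_unit_of e -> is_unit_of (pi e).
  move=> se e1; apply: (cover_ind _ ci).
    by apply: closed_star_subalgebra_unit; rewrite -pis se.
  by move=> a; rewrite /= -pij /= -!piM (e1 (j a)).1 (e1 (j a)).2.
by split; rewrite -pis -piM; apply: unit_pi => //; rewrite starM starK.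
Qed.

Lemma locally_inner_cover_le {R : realType} {A : operatorAlgebraType R}
    {G : topologicalGroupType} {alpha : G -> A -> A}
    {C D : cstarAlgebraType R} {j : A -> C} {i : A -> D} :
  cstar_cover i -> cover_le i j ->
  locally_inner alpha j -> locally_inner alpha i.
Proof.
move=> ci [pi pih pij] inner s; have [u uu ju] := inner s.
exists (pi u); first exact: (cover_le_unitary _ ci pih pij).
have [[_ piM] pis] := pih; rewrite -pij; apply/funext => a /=.
by have /= -> := congr1 (@^~ a) ju; rewrite /ad !piM pis.
Qed.

Theorem theorem4p10 (R : realType) (A : operatorAlgebraType R)
    (G : topologicalGroupType) (alpha : G -> A -> A)
    (C : cstarAlgebraType R) (j : A -> C) :
  dynamical_system alpha -> unital A ->
  cstar_cover j -> locally_inner alpha j ->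
  admissible alpha j /\
  (forall (D : cstarAlgebraType R) (i : A -> D),
     cstar_cover i -> cover_le i j ->
     admissible alpha i /\ locally_inner alpha i).
Proof.
move=> [_ _ act cont _] _ cj inner; split.
  exact: locally_inner_admissible.
move=> D i ci ij.
have inneri := locally_inner_cover_le ci ij inner.
by split=> //; exact: locally_inner_admissible.
Qed.
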